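(* For integers $n\ge2$ and $0\le k\le n-1$, $$|\mathcal{E}(\mathrm{SSB}(n,k))|=[x^n](1+x+x^2)^n+2\,[x^{n-k}](1+x+x^2)^n.$$
   Context: $[x^j]f(x)$ denotes the coefficient of $x^j$ in the polynomial $f(x)$. The Ewald set of a polytope $P\subset\mathbb{R}^n$ is $\mathcal{E}(P):=\mathbb{Z}^n\cap P\cap(-P)$. For $n\ge2$ and $0\le k\le n-1$, $\mathrm{SSB}(n,k)\subset\mathbb{R}^n$ is the polytope defined by the inequalities $x_i\ge-1$ for $i=1,\dots,n$; $x_1\le1$; and $kx_1+x_2+\dots+x_n\le1$. *)

(* Defs.v *)
From HB Require Import structures.
From mathcomp Require Import all_boot all_order all_algebra finmap.
From mathcomp Require Import boolp classical_sets cardinality reals.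

Set Implicit Arguments.
Unset Strict Implicit.
Unset Printing Implicit Defensive.

Import Order.TTheory GRing.Theory Num.Theory.
Local Open Scope classical_set_scope.
Local Open Scope ring_scope.

Definition integer_lattice (R : realType) (n : nat) : set 'rV[R]_n :=
  [set x | forall i, x 0 i \is a Num.int].
Arguments integer_lattice : clear implicits.

Definition ewald (R : realType) (n : nat) (P : set 'rV[R]_n) : set 'rV[R]_n :=
  integer_lattice R n `&` P `&` [set - x | x in P].

(* Coordinates are numbered from 0: the distinguished coordinate x_1 of SSB(n,k)
   is the one of index 0. It is designated by [i = 0 :> nat] so that the
   definition makes sense for every n; for n > 0 the first sum below has the
   single term x_1. *)
Definition SSB (R : realType) (n k : nat) : set 'rV[R]_n :=
  [set x | [/\ forall i : 'I_n, -1 <= x 0 i,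
               forall i : 'I_n, i = 0%N :> nat -> x 0 i <= 1
             & k%:R * (\sum_(i < n | i == 0%N :> nat) x 0 i)
               + \sum_(i < n | i != 0%N :> nat) x 0 i <= 1]].
Arguments SSB : clear implicits.

(* Main.v *)
Require Import Defs.
From HB Require Import structures.
From mathcomp Require Import all_boot all_order all_algebra finmap.
From mathcomp Require Import boolp classical_sets cardinality reals.
From mathcomp Require Import zify ring lra.

Set Implicit Arguments.
Unset Strict Implicit.
Unset Printing Implicit Defensive.

Import Order.TTheory GRing.Theory Num.Theory.
Local Open Scope classical_set_scope.
Local Open Scope ring_scope.

(** A lattice point of the Ewald set has all its coordinates in {-1, 0, 1},
    and so does the value of the linear form [k x_1 + x_2 + ... + x_n] on it:
    passing to [P] and [- P] makes every defining inequality two-sided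
    ([ewald_SSBP]). Adding 1 turns all these numbers into digits 0, 1, 2. If [a] is the digit of
    [x_1], and [g_1] the digit of minus the linear form, and [g_i] the digit of
    [x_i] for [i > 1], then the definition of [g_1] becomes the single equation
    [g_1 + ... + g_n + k a = n + k] ([ewald_SSB_points]). So the Ewald set is in
    bijection with the pairs [(a, g)] solving it: the slack of the last
    inequality takes the place left vacant by [x_1] in the word [g].

    For fixed [a], the words [g] of digits with sum [s] are counted by the
    coefficient of [x^s] in [(1 + x + x^2)^n] ([coef_trinomial_exp]). The three
    values of [a] give the coefficients of index [n + k], [n] and [n - k]; the
    first and the last agree because the trinomial is palindromic
    ([card_words_sym]). *)

Definition words (n s : nat) : {set {ffun 'I_n -> 'I_3}} :=
  [set g : {ffun 'I_n -> 'I_3} | (\sum_i g i)%N == s].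

(** Expanding the product, a choice of one monomial in each factor is a word,
    and the exponents add up. *)
Lemma coef_trinomial_exp (n s : nat) :
  ((1 + 'X + 'X^2 : {poly int}) ^+ n)`_s = (#|words n s|)%:Z.
Proof.
have -> : (1 + 'X + 'X^2 : {poly int}) = \sum_(j < 3) 'X^j.
  by rewrite !big_ord_recr big_ord0 /= add0r expr0 expr1.
rewrite -[in LHS](card_ord n) -prodr_const bigA_distr_bigA /= coef_sum.
under eq_bigr => g _ do rewrite -expr_sum coefXn eq_sym.
rewrite -natr_sum natz -sum1dep_card [in RHS]big_mkcond.
by congr Posz; apply: eq_bigr => g _; case: eqP.
Qed.

(** The digit reversal [d |-> 2 - d] changes the sum [s] into [2 n - s]. *)
Lemma card_words_sym (n k : nat) (hk : (k <= n)%N) :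
  #|words n (n + k)| = #|words n (n - k)|.
Proof.
pose r (g : {ffun 'I_n -> 'I_3}) := [ffun i => rev_ord (g i)].
have rK : involutive r by move=> g; apply/ffunP => i; rewrite !ffunE rev_ordK.
rewrite -(card_preimset _ (inv_inj rK)); apply: eq_card => g; rewrite !inE.
have sum_r : (\sum_i r g i + \sum_i g i = 2 * n)%N.
  rewrite -big_split /= (eq_bigr (fun=> 2)%N) ?sum_nat_const ?card_ord 1?mulnC //.
  by move=> i _; rewrite ffunE /= subSS subnK // -ltnS ltn_ord.
move: sum_r; set S := (\sum_i r g i)%N; set T := (\sum_i g i)%N => sum_r.
by apply/eqP/eqP; lia.
Qed.

Definition weight (m k : nat) (p : 'I_3 * {ffun 'I_m.+1 -> 'I_3}) : nat :=
  (\sum_i p.2 i + k * p.1)%N.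

(** The pairs [(a, g)] that encode the Ewald set of [SSB R m.+1 k]. *)
Definition codes (m k : nat) : {set 'I_3 * {ffun 'I_m.+1 -> 'I_3}} :=
  [set p | weight k p == (m.+1 + k)%N].

Lemma card_codes (m k : nat) (hk : (k <= m.+1)%N) :
  #|codes m k| = (#|words m.+1 m.+1| + 2 * #|words m.+1 (m.+1 - k)|)%N.
Proof.
have fiber (a : 'I_3) :
    (\sum_(g : {ffun 'I_m.+1 -> 'I_3} | weight k (a, g) == m.+1 + k) 1
      = #|words m.+1 (m.+1 + k - k * a)|)%N.
  rewrite -sum1_card; apply: eq_bigl => g; rewrite !inE /weight /=.
  by have := leq_ord a; set S := (\sum_i g i)%N => ha; apply/eqP/eqP; nia.
rewrite -sum1_card; under eq_bigl do rewrite inE.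
transitivity (\sum_(a : 'I_3)
    \sum_(g : {ffun 'I_m.+1 -> 'I_3} | weight k (a, g) == m.+1 + k) 1)%N.
  by rewrite pair_big_dep /=; apply: eq_bigl => -[a g].
under eq_bigr do rewrite fiber.
rewrite !big_ord_recr big_ord0 /= add0n muln0 subn0 muln1 addnK card_words_sym //.
have -> : (m.+1 + k - k * 2 = m.+1 - k)%N by lia.
by rewrite mul2n -addnn addnCA addnA.
Qed.

(** The digit [p.2 ord0] is not a coordinate: it stands for the slack of the
    last inequality, see [SSB_form_point]. *)
Definition point (R : realType) (m : nat)
    (p : 'I_3 * {ffun 'I_m.+1 -> 'I_3}) : 'rV[R]_m.+1 :=
  \row_i ((if i == ord0 then p.1 else p.2 i)%:R - 1).

Lemma pointE (R : realType) (m : nat) (p : 'I_3 * {ffun 'I_m.+1 -> 'I_3}) i :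
  point R p 0 i = (if i == ord0 then p.1 else p.2 i)%:R - 1.
Proof. by rewrite mxE. Qed.

Definition SSB_form (R : realType) (m k : nat) (x : 'rV[R]_m.+1) : R :=
  k%:R * x 0 ord0 + \sum_(i < m.+1 | i != ord0) x 0 i.

Lemma SSB_form_point (R : realType) (m k : nat)
    (p : 'I_3 * {ffun 'I_m.+1 -> 'I_3}) :
  SSB_form k (point R p) = (weight k p)%:R - (m + k)%:R - (p.2 ord0)%:R.
Proof.
rewrite /SSB_form.
under eq_bigr => i ni do rewrite pointE (negbTE ni).
rewrite pointE eqxx sumrB sumr_const cardC1 card_ord /= /weight.
rewrite !natrD natrM natr_sum [in RHS](bigD1 ord0) //=; ring.
Qed.

Lemma ewald_SSBP (R : realType) (m k : nat) (x : 'rV[R]_m.+1) :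
  ewald (SSB R m.+1 k) x <->
  [/\ forall i, x 0 i \is a Num.int, forall i, `|x 0 i| <= 1
    & `|SSB_form k x| <= 1].
Proof.
have form (y : 'rV[R]_m.+1) : k%:R * (\sum_(i < m.+1 | i == 0%N :> nat) y 0 i)
     + \sum_(i < m.+1 | i != 0%N :> nat) y 0 i = SSB_form k y.
  by rewrite /SSB_form (big_pred1 ord0).
have formN : SSB_form k (- x) = - SSB_form k x.
  rewrite /SSB_form mxE mulrN; under eq_bigr do rewrite mxE.
  by rewrite sumrN opprD.
split=> [[[xi [lo hi0 fo]] [y [lo' _ fo'] yx]]|[xi x1 f1]].
  have {yx}yE : y = - x by rewrite -yx opprK.
  move: fo fo'; rewrite !form yE formN => fo fo'.
  split=> // [i|]; last by rewrite ler_norml; lra.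
  by have := lo i; have := lo' i; rewrite yE mxE ler_norml; lra.
have bnd i : -1 <= x 0 i <= 1 by rewrite -ler_norml.
move: f1; rewrite ler_norml => f1.
split; [split=> //|exists (- x); last exact: opprK].
  by split=> [i|i _|]; rewrite ?form; move: (bnd i) f1 || move: f1; lra.
by split=> [i|i _|]; rewrite ?form ?formN ?mxE; move: (bnd i) f1 || move: f1; lra.
Qed.

Lemma int_norm_le1_digit (R : realType) (z : R) :
  z \is a Num.int -> `|z| <= 1 -> exists d : 'I_3, z = d%:R - 1.
Proof.
move=> /intrP[t ->]; rewrite -intr_norm lerz1 => ht.
have lt3 : (absz (t + 1)%R < 3)%N by lia.
exists (Ordinal lt3) => /=.
have {1}-> : t = (absz (t + 1)%R)%:Z - 1 by lia.
by rewrite rmorphB /=.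
Qed.

Lemma digit_int (R : realType) (d : 'I_3) : (d%:R - 1 : R) \is a Num.int.
Proof. by rewrite rpredB // ?rpred1 // rpred_nat. Qed.

Lemma digit_norm (R : realType) (d : 'I_3) : `|d%:R - 1 : R| <= 1.
Proof.
have : (d%:R : R) <= 2%:R by rewrite ler_nat -ltnS.
by have := ler0n R d; rewrite ler_norml; lra.
Qed.

(** The reason for the equation defining [codes]: by [SSB_form_point] it says
    that the digit at position 0 of the word [g] of a point [x] is that of
    [- SSB_form k x]; the other digits of [g] are those of [x]. *)
Lemma ewald_SSB_points (R : realType) (m k : nat) :
  ewald (SSB R m.+1 k) = [set point R p | p in [set` codes m k]].
Proof.
apply/seteqP; split=> x /=.
  move=> /ewald_SSBP[xi x1 f1].
  have [d dE] := fin_all_exists (fun i => int_norm_le1_digit (xi i) (x1 i)).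
  have [c cE] : exists c : 'I_3, - SSB_form k x = c%:R - 1.
    apply: int_norm_le1_digit; rewrite ?normrN // rpredN rpredD //.
      by rewrite rpredM // rpred_nat.
    by apply: rpred_sum => i _.
  pose p := (d ord0, [ffun i => if i == ord0 then c else d i]).
  have pE : point R p = x.
    apply/rowP => i; rewrite pointE dE /= ffunE.
    by case: eqP => // ->.
  exists p => //; rewrite inE.
  (* Compare the two values of the form on [x]: [cE] and [SSB_form_point]. *)
  have := SSB_form_point R k p; rewrite pE /= ffunE eqxx => fE.
  rewrite -(eqr_nat R) addSn -natr1; apply/eqP; lra.
move=> [p]; rewrite inE => /eqP wE <-; apply/ewald_SSBP; split=> [i|i|].
- by rewrite pointE digit_int.
- by rewrite pointE digit_norm.
rewrite SSB_form_point wE addSn -natr1 -normrN.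
have -> : - ((m + k)%:R + 1 - (m + k)%:R - (p.2 ord0)%:R) = (p.2 ord0)%:R - 1 :> R.
  by ring.
exact: digit_norm.
Qed.

(** The point determines [a] and [g] outside position 0, and the equation then
    determines the remaining digit. *)
Lemma point_inj (R : realType) (m k : nat) :
  {in codes m k &, injective (@point R m)}.
Proof.
move=> [a g] [b h]; rewrite !inE => /eqP wg /eqP wh E.
have dig (c d : 'I_3) : c%:R - 1 = d%:R - 1 :> R -> c = d.
  by move=> /addIr/eqP; rewrite eqr_nat => /eqP /val_inj.
have ab : a = b by apply: dig; have /rowP/(_ ord0) := E; rewrite !pointE.
have ghN i : i != ord0 -> g i = h i.
  by move=> /negbTE ni; apply: dig; have /rowP/(_ i) := E; rewrite !pointE ni.
congr (_, _); first exact: ab.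
apply/ffunP => i; have [->|/ghN //] := eqVneq i ord0.
move: wg; rewrite -wh /weight ab /= => /eqP; rewrite eqn_add2r.
rewrite (bigD1 ord0) //= [X in _ == X](bigD1 ord0) //=.
by rewrite (eq_bigr _ (fun i ni => congr1 val (ghN i ni))) eqn_add2r => /eqP/val_inj.
Qed.

Theorem theorem6p9 (R : realType) (n k : nat) (hn : (2 <= n)%N)
    (hk : (k <= n - 1)%N) :
  finite_set (ewald (SSB R n k)) /\
  (#|` fset_set (ewald (SSB R n k))|)%:Z =
    ((1 + 'X + 'X^2 : {poly int}) ^+ n)`_n
    + 2 * ((1 + 'X + 'X^2 : {poly int}) ^+ n)`_(n - k).
Proof.
case: n hn hk => // m _ hk.
have -> : ewald (SSB R m.+1 k) =
    [set` [fset point R p | p in codes m k]%fset].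
  rewrite ewald_SSB_points; apply/seteqP; split=> x /=.
    by move=> [p pc <-]; apply/imfsetP; exists p.
  by move=> /imfsetP[p pc ->]; exists p.
split; first exact: finite_fset.
rewrite set_fsetK card_in_imfset; last exact: point_inj.
rewrite !coef_trinomial_exp -cardE card_codes; lia.
Qed.
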